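(* Let $N$ be a developable regular ruled surface in $E^3$ with parametrization $\vec r(s,v)=\vec c(s)+v\vec q(s)$, $\|\vec q(s)\|=1$, where $\vec c$ is the striction curve (striction line) of $N$ and $s$ is the arc length parameter of $\vec c$, with Frenet frame $\{\vec q,\vec h,\vec a\}$ and non-zero invariants $k_1,k_2$. Then $N$ is an $h$-slant ruled surface if and only if the striction line $\vec c$ is a slant helix in $E^3$.
   Context: $E^3$ is Euclidean 3-space; all maps are smooth and defined on an open interval $I\subset\mathbb R$. $N$ is given by $\vec r(s,v)=\vec c(s)+v\vec q(s)$, where $\vec c$ is a unit speed curve and $\vec q$ is a unit vector field along $\vec c$ (the ruling). ''Regular'' refers to the base curve $\vec c$ being a regular curve. That $\vec c$ is the striction curve means $\langle \vec c\,',\vec q\,'\rangle=0$. Frenet frame of $N$: $\vec a=\dfrac{\vec q\times\vec q\,'}{\|\vec q\,'\|}$ (central tangent), $\vec h=\vec a\times\vec q$ (central normal). The invariants $k_1,k_2$ are the functions in the Frenet formulae $$\vec q\,'=k_1\vec h,\qquad \vec h'=-k_1\vec q+k_2\vec a,\qquad \vec a'=-k_2\vec h,$$ with $'=d/ds$; both are assumed non-zero. $N$ is developable if its distribution parameter $d=\det(\vec c\,',\vec q,\vec q\,')/\langle\vec q\,',\vec q\,'\rangle$ vanishes identically. $N$ is called $h$-slant if the central normal $\vec h$ makes a constant angle $\varphi\neq\pi/2$ with a fixed non-zero direction, i.e. there is a fixed unit vector $\vec u$ with $\langle\vec h(s),\vec u\rangle=\cos\varphi=$ constant, $\varphi\neq\pi/2$.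 A curve in $E^3$ is a slant helix if its (principal) normal lines make a constant angle with a fixed direction.
   Formalization: In the definition of slant helix the constant angle is also required to differ from π/2, as for h-slant surfaces; otherwise the tangent developable of a circular helix (normals orthogonal to the axis, but not h-slant) is a counterexample. *)

(* Defs.v *)
From mathcomp Require Import all_boot all_order all_algebra.
From mathcomp Require Import all_classical all_reals all_analysis.
Set Implicit Arguments.
Unset Strict Implicit.
Unset Printing Implicit Defensive.
Import Order.TTheory GRing.Theory Num.Theory numFieldNormedType.Exports.
Local Open Scope ring_scope.
Local Open Scope classical_set_scope.

(* The library norm `|u| on 'rV[R]_3 is the sup norm; the Euclidean norm of
   E^3 is [enorm]. The two induce the same topology, hence the same derivative
   [derive1 f] of curves. *)
Definition dotp (R : realType) (u v : 'rV[R]_3) : R :=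
  \sum_(i < 3) u 0 i * v 0 i.

Definition enorm (R : realType) (u : 'rV[R]_3) : R := Num.sqrt (dotp u u).

(* The indices k + 1 and k + 2 are taken modulo 3 in 'I_3. *)
Definition crossp (R : realType) (u v : 'rV[R]_3) : 'rV[R]_3 :=
  \row_(k < 3) (u 0 (k + 1) * v 0 (k + 2) - u 0 (k + 2) * v 0 (k + 1)).

Definition det3 (R : realType) (u v w : 'rV[R]_3) : R :=
  \det (\matrix_(i < 3) tnth [tuple u; v; w] i).

Definition smooth_on (R : realType) (I : set R) (f : R -> 'rV[R]_3) : Prop :=
  forall (n : nat) (s : R), I s -> derivable (derive1n n f) s 1.

(* Functions are total on R; only their values on the open interval [rs_dom]
   are meaningful. *)
Record ruledSurface (R : realType) : Type := RuledSurface {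
  rs_dom : set R;
  rs_base : R -> 'rV[R]_3;
  rs_ruling : R -> 'rV[R]_3;
  rs_dom_open : open rs_dom;
  rs_dom_interval : is_interval rs_dom;
  rs_base_smooth : smooth_on rs_dom rs_base;
  rs_ruling_smooth : smooth_on rs_dom rs_ruling;
  rs_ruling_unit : forall s, rs_dom s -> enorm (rs_ruling s) = 1 }.

Definition rs_param (R : realType) (N : ruledSurface R) (s v : R) : 'rV[R]_3 :=
  rs_base N s + v *: rs_ruling N s.

Definition regular_curve (R : realType) (I : set R) (c : R -> 'rV[R]_3) : Prop :=
  forall s, I s -> derive1 c s != 0.

Definition unit_speed (R : realType) (I : set R) (c : R -> 'rV[R]_3) : Prop :=
  forall s, I s -> enorm (derive1 c s) = 1.

Definition base_is_striction (R : realType) (N : ruledSurface R) : Prop :=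
  forall s, rs_dom N s -> dotp (derive1 (rs_base N) s) (derive1 (rs_ruling N) s) = 0.

(* q' <> 0 on the domain: this is what makes the divisions in the distribution
   parameter and in the central tangent meaningful. *)
Definition noncylindrical (R : realType) (N : ruledSurface R) : Prop :=
  forall s, rs_dom N s -> derive1 (rs_ruling N) s != 0.

Definition distribution_parameter (R : realType) (N : ruledSurface R) (s : R) : R :=
  det3 (derive1 (rs_base N) s) (rs_ruling N s) (derive1 (rs_ruling N) s)
  / dotp (derive1 (rs_ruling N) s) (derive1 (rs_ruling N) s).

Definition developable (R : realType) (N : ruledSurface R) : Prop :=
  forall s, rs_dom N s -> distribution_parameter N s = 0.

Definition central_tangent (R : realType) (N : ruledSurface R) (s : R) : 'rV[R]_3 :=
  (enorm (derive1 (rs_ruling N) s))^-1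
    *: crossp (rs_ruling N s) (derive1 (rs_ruling N) s).

Definition central_normal (R : realType) (N : ruledSurface R) (s : R) : 'rV[R]_3 :=
  crossp (central_tangent N s) (rs_ruling N s).

Definition frenet_invariants (R : realType) (N : ruledSurface R)
    (k1 k2 : R -> R) : Prop :=
  forall s, rs_dom N s ->
    [/\ derive1 (rs_ruling N) s = k1 s *: central_normal N s,
        derive1 (central_normal N) s
          = - (k1 s *: rs_ruling N s) + k2 s *: central_tangent N s
      & derive1 (central_tangent N) s = - (k2 s *: central_normal N s)].

(* The unit vector field [f] makes a constant angle phi <> pi/2 with a fixed
   direction. The bounds on phi make it an angle, so that phi <> pi/2 does
   exclude orthogonality. *)
Definition constant_angle (R : realType) (I : set R) (f : R -> 'rV[R]_3) : Prop :=
  exists (u : 'rV[R]_3) (phi : R),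
    [/\ enorm u = 1, 0 <= phi <= pi, phi != pi / 2
      & forall s, I s -> dotp (f s) u = cos phi].

Definition h_slant (R : realType) (N : ruledSurface R) : Prop :=
  constant_angle (rs_dom N) (central_normal N).

Definition unit_tangent (R : realType) (c : R -> 'rV[R]_3) (s : R) : 'rV[R]_3 :=
  (enorm (derive1 c s))^-1 *: derive1 c s.

Definition principal_normal (R : realType) (c : R -> 'rV[R]_3) (s : R) : 'rV[R]_3 :=
  (enorm (derive1 (unit_tangent c) s))^-1 *: derive1 (unit_tangent c) s.

(* The first conjunct says that the principal normal exists on I. As for
   [h_slant], the angle pi/2 is excluded: every general helix has its principal
   normals orthogonal to its axis, but the tangent developable of a circular
   helix is not h-slant. *)
Definition slant_helix (R : realType) (I : set R) (c : R -> 'rV[R]_3) : Prop :=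
  (forall s, I s -> derive1 (unit_tangent c) s != 0)
  /\ constant_angle I (principal_normal c).

(* Main.v *)
(* Since c is the striction curve and the surface is developable, c' is
   orthogonal to q' and to q x q', so c' = e q with e = <c', q> = 1 or -1.  By
   continuity e is constant on the interval, hence c'' = e q', and the principal
   normal of c is e q' / |q'| = e h.  When e = -1 the angle is preserved by
   replacing the axis u with -u. *)
Require Import Defs.
From mathcomp Require Import all_boot all_order all_algebra.
From mathcomp Require Import all_classical all_reals all_analysis.
From mathcomp Require Import ring.
Import Order.TTheory GRing.Theory Num.Theory numFieldNormedType.Exports.
Local Open Scope ring_scope.
Local Open Scope classical_set_scope.

Section VectorAlgebra.
Context {R : realType}.
Implicit Types (u v w : 'rV[R]_3) (a : R).

Lemma dotpE u v :
  dotp u v = u 0 0 * v 0 0 + u 0 1 * v 0 1 + u 0 2 * v 0 2.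
Proof.
rewrite /dotp !big_ord_recl big_ord0 addr0 addrA.
by congr (_ * _ + _ * _ + _ * _); congr (_ _ _); apply/val_inj.
Qed.

(** Vector identities become three polynomial identities for [ring]. Writing every index as a
    numeral of ['I_3] gives equal coordinates the same atom. *)
Lemma row3P u v :
  u 0 0 = v 0 0 -> u 0 1 = v 0 1 -> u 0 2 = v 0 2 -> u = v.
Proof.
move=> e0 e1 e2; apply/rowP => -[[|[|[|//]]] lt_i3].
- by rewrite (_ : Ordinal _ = 0) //; apply/val_inj.
- by rewrite (_ : Ordinal _ = 1) //; apply/val_inj.
- by rewrite (_ : Ordinal _ = 2) //; apply/val_inj.
Qed.

Lemma crosspE u v :
  (crossp u v 0 0 = u 0 1 * v 0 2 - u 0 2 * v 0 1) *
  (crossp u v 0 1 = u 0 2 * v 0 0 - u 0 0 * v 0 2) *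
  (crossp u v 0 2 = u 0 0 * v 0 1 - u 0 1 * v 0 0).
Proof.
by split; [split|]; rewrite mxE;
   congr (_ * _ - _ * _); congr (_ _ _); apply/val_inj.
Qed.

Lemma dotpC u v : dotp u v = dotp v u.
Proof. by rewrite !dotpE; ring. Qed.

Lemma dotpZl a u v : dotp (a *: u) v = a * dotp u v.
Proof. by rewrite !dotpE !mxE; ring. Qed.

Lemma dotpNl u v : dotp (- u) v = - dotp u v.
Proof. by rewrite !dotpE !mxE; ring. Qed.

Lemma crosspZl a u v : crossp (a *: u) v = a *: crossp u v.
Proof. by apply: row3P; rewrite !(crosspE, mxE); ring. Qed.

Lemma crosspC u v : crossp u v = - crossp v u.
Proof. by apply: row3P; rewrite !(crosspE, mxE); ring. Qed.

(** Expansion of the vector triple product; all later cross product computations go through it. *)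
Lemma crossp_crossp u v w :
  crossp (crossp u v) w = dotp u w *: v - dotp v w *: u.
Proof. by apply: row3P; rewrite !(crosspE, mxE) !dotpE; ring. Qed.

Lemma dotp_crosspr u v : dotp v (crossp u v) = 0.
Proof. by rewrite dotpE !crosspE; ring. Qed.

(** Lagrange's identity. *)
Lemma dotp_crossp u v :
  dotp (crossp u v) (crossp u v) = dotp u u * dotp v v - dotp u v ^+ 2.
Proof. by rewrite !dotpE !crosspE; ring. Qed.

(** The scalar triple product turns developability into orthogonality of c' and q x q'. *)
Lemma det3E u v w : det3 u v w = dotp u (crossp v w).
Proof.
rewrite dotpE !crosspE /det3 (expand_det_row _ 0) !big_ord_recl big_ord0.
rewrite /cofactor !(expand_det_row _ 0) !big_ord_recl !big_ord0 /cofactor.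
rewrite !det_mx11 !mxE !(tnth_nth 0) /=.
(* Cofactor expansion leaves different terms of ['I_3] with equal values. Reading coordinates
   through a function on [nat] lets simplification identify them before [ring]. *)
have [X XE] : exists X : 'rV[R]_3 -> nat -> R,
    forall (x : 'rV[R]_3) (i : 'I_3), x 0 i = X x i.
  by exists (fun x n => x 0 (inord n)) => x i; rewrite inord_val.
rewrite !XE /= /bump /= !(addn0, add0n).
by ring.
Qed.

Lemma dotp_eq0 u : (dotp u u == 0) = (u == 0).
Proof.
apply/eqP/eqP => [|->]; last by rewrite dotpE !mxE !mulr0 !addr0.
rewrite /dotp => /eqP; rewrite psumr_eq0 => [/allP u0|i _]; last exact: sqr_ge0.
apply/rowP => i; rewrite mxE; apply/eqP.
by have := u0 i (mem_index_enum i); rewrite mulf_eq0 orbb.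
Qed.

Lemma dotp_ge0 u : 0 <= dotp u u.
Proof. by apply: sumr_ge0 => i _; exact: sqr_ge0. Qed.

Lemma enorm_eq1 u : enorm u = 1 -> dotp u u = 1.
Proof. by move=> u1; rewrite -(sqr_sqrtr (dotp_ge0 u)) -/(enorm u) u1 expr1n. Qed.

Lemma enormN u : enorm (- u) = enorm u.
Proof. by rewrite /enorm dotpNl dotpC dotpNl opprK. Qed.

End VectorAlgebra.

(** * Constant angles, continuity and derivatives on an interval *)

Lemma constant_angleN {R : realType} (I : set R) (f g : R -> 'rV[R]_3) :
  (forall s, I s -> g s = - f s) -> constant_angle I f -> constant_angle I g.
Proof.
move=> gNf [u [phi [u1 phi_le phiN fu]]]; exists (- u), phi.
split => // [|s Is]; first by rewrite enormN.
by rewrite gNf // dotpC !dotpNl dotpC dotpNl opprK fu.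
Qed.

Lemma constant_angle_eq {R : realType} (I : set R) (f g : R -> 'rV[R]_3) :
  (forall s, I s -> g s = f s) -> constant_angle I f -> constant_angle I g.
Proof.
move=> gf [u [phi [u1 phi_le phiN fu]]]; exists u, phi.
by split => // s Is; rewrite gf // fu.
Qed.

Lemma continuous_dotp {R : realType} (f g : R -> 'rV[R]_3) (s : R) :
  {for s, continuous f} -> {for s, continuous g} ->
  {for s, continuous (fun t => dotp (f t) (g t))}.
Proof.
move=> fs gs; have coordE (h : R -> 'rV[R]_3) j :
    {for s, continuous h} -> (fun t => h t 0 j) @ s --> h s 0 j.
  move=> hs; apply: (@continuous_comp _ _ _ h (fun M : 'rV[R]_3 => M 0 j) s hs).
  exact: coord_continuous.
suff : (fun t => dotp (f t) (g t)) @ s --> dotp (f s) (g s) by [].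
rewrite dotpE; under eq_fun do rewrite dotpE.
by do 2?apply: cvgD; apply: cvgM; exact: coordE.
Qed.

(** The image of an interval is connected, hence an interval. If it contained both -1 and 1 it would
    contain 0, whose square is not 1. *)
Lemma continuous_sign_constant {R : realType} (I : set R) (f : R -> R) :
  is_interval I -> {in I, continuous f} -> (forall s, I s -> f s ^+ 2 = 1) ->
  (forall s, I s -> f s = 1) \/ (forall s, I s -> f s = -1).
Proof.
move=> I_itv f_cont f_sq.
have f_itv : is_interval [set f s | s in I].
  apply/connected_intervalP/connected_continuous_connected.
    exact/connected_intervalP.
  exact: continuous_in_subspaceT.
have f_sign s : I s -> f s = 1 \/ f s = -1.
  by move=> /f_sq/eqP; rewrite sqrf_eq1 => /orP[]/eqP; [left|right].
have [|/existsNP[s /not_implyP[Is fs_neq1]]] :=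
  pselect (forall s, I s -> f s = 1); first by left.
have fs : f s = -1 by case: (f_sign s Is).
right=> t It; case: (f_sign t It) => // ft.
have [r Ir fr0] : [set f s | s in I] 0.
  by apply: (f_itv (-1) 1); [exists s|exists t|rewrite lerN10 ler01].
by have /eqP := f_sq r Ir; rewrite fr0 expr0n eq_sym oner_eq0.
Qed.

(** Openness makes I a neighbourhood of s, so the arbitrary values outside I do not affect the
    derivative at s. *)
Lemma derive1_eq_on {R : realType} (I : set R) (f g : R -> 'rV[R]_3) (s : R) :
  open I -> I s -> (forall t, I t -> f t = g t) -> derive1 f s = derive1 g s.
Proof.
move=> Io Is fg; rewrite !derive1E; apply: near_eq_derive.
by near=> t; apply: fg; near: t; exact: open_nbhs_nbhs.
Unshelve. all: by end_near. Qed.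

(** * The tangent and principal normal of the striction line *)

Section StrictionLine.
Context {R : realType} (N : ruledSurface R) (k1 k2 : R -> R).
Local Notation I := (rs_dom N).
Local Notation c := (rs_base N).
Local Notation q := (rs_ruling N).
Hypothesis unit_c : unit_speed I c.
Hypothesis striction_c : base_is_striction N.
Hypothesis noncyl : noncylindrical N.
Hypothesis frenet : frenet_invariants N k1 k2.
Hypothesis dev : developable N.

Let qq1 s : I s -> dotp (q s) (q s) = 1.
Proof. by move=> Is; exact/enorm_eq1/rs_ruling_unit. Qed.

(** By the first Frenet formula q' is a multiple of h = a x q, which is orthogonal to q. *)
Let qq's s : I s -> dotp (q s) (derive1 q s) = 0.
Proof.
move=> Is; have [-> _ _] := frenet _ Is.
by rewrite dotpC dotpZl dotpC dotp_crosspr mulr0.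
Qed.

(** The triple product gives (q x q') x q = <q, q> q' - <q', q> q = q'. *)
Lemma central_normalE s : I s ->
  central_normal N s = (enorm (derive1 q s))^-1 *: derive1 q s.
Proof.
move=> Is; rewrite /central_normal crosspZl crossp_crossp qq1 //.
by rewrite (dotpC (derive1 q s)) qq's // scale1r scale0r subr0.
Qed.

(* With w = q' and n = q x w one has c' x n = - <c', q> w, because c' is
   orthogonal to w; taking the product with n, which is orthogonal to c' by
   developability, gives |w|^2 c' = <c', q> |w|^2 q. *)
Lemma base_derive_ruling s : I s ->
  derive1 c s = dotp (derive1 c s) (q s) *: q s.
Proof.
move=> Is; set u := derive1 c s; set w := derive1 q s; set n := crossp (q s) w.
have ww : dotp w w != 0 by rewrite dotp_eq0; exact: noncyl.
have un : dotp u n = 0.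
  rewrite -det3E; apply/eqP; move/eqP: (dev _ Is).
  by rewrite /distribution_parameter mulf_eq0 invr_eq0 (negbTE ww) orbF.
have nn : dotp n n = dotp w w.
  by rewrite dotp_crossp qq1 // qq's // mul1r expr0n subr0.
have nu : crossp n u = dotp u (q s) *: w.
  by rewrite crossp_crossp (dotpC w) striction_c // scale0r subr0 (dotpC (q s)).
have nw : crossp n w = - (dotp w w *: q s).
  by rewrite crossp_crossp qq's // scale0r sub0r.
have : crossp (crossp n u) n = dotp n n *: u.
  by rewrite crossp_crossp un scale0r subr0.
rewrite nu nn crosspZl crosspC nw opprK scalerA mulrC -scalerA.
by move/(scalerI ww)/esym.
Qed.

(** Substituting c' = <c', q> q for one factor of <c', c'> = 1 leaves <c', q>^2. *)
Lemma base_ruling_sqr s : I s -> dotp (derive1 c s) (q s) ^+ 2 = 1.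
Proof.
move=> Is; rewrite -(enorm_eq1 _ (unit_c _ Is)) {2}base_derive_ruling // dotpZl.
by rewrite (dotpC (q s)) -expr2.
Qed.

Lemma base_derive_sign :
  (forall s, I s -> derive1 c s = q s) \/ (forall s, I s -> derive1 c s = - q s).
Proof.
have cont : {in I, continuous (fun s => dotp (derive1 c s) (q s))}.
  move=> s /[!inE] Is; apply: continuous_dotp.
    apply/differentiable_continuous/derivable1_diffP.
    (* Continuity of c' needs derivability of the first derivative, hence n = 1; for q itself n = 0
       is enough. *)
    exact: (rs_base_smooth (n := 1)).
  apply/differentiable_continuous/derivable1_diffP.
  exact: (rs_ruling_smooth (n := 0)).
have [e1|e1] := continuous_sign_constant _ _ (@rs_dom_interval _ N) cont
  base_ruling_sqr.
  by left=> s Is; rewrite base_derive_ruling // e1 // scale1r.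
by right=> s Is; rewrite base_derive_ruling // e1 // scaleN1r.
Qed.

Lemma unit_tangentE s : I s -> unit_tangent c s = derive1 c s.
Proof. by move=> Is; rewrite /unit_tangent unit_c // invr1 scale1r. Qed.

Lemma derive_unit_tangent :
  (forall s, I s -> derive1 (unit_tangent c) s = derive1 q s) \/
  (forall s, I s -> derive1 (unit_tangent c) s = - derive1 q s).
Proof.
have [c'q|c'q] := base_derive_sign; [left|right] => s Is.
  apply: (derive1_eq_on _ _ _ _ (@rs_dom_open _ N) Is) => t It.
  by rewrite unit_tangentE // c'q.
rewrite (derive1_eq_on _ _ (- q) _ (@rs_dom_open _ N) Is) => [|t It].
  by rewrite !derive1E deriveN //; exact: (rs_ruling_smooth (n := 0)).
by rewrite unit_tangentE // c'q.
Qed.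

Lemma principal_normal_central_normal :
  (forall s, I s -> principal_normal c s = central_normal N s) \/
  (forall s, I s -> principal_normal c s = - central_normal N s).
Proof.
have [T'|T'] := derive_unit_tangent; [left|right] => s Is.
  by rewrite central_normalE // /principal_normal T'.
by rewrite central_normalE // /principal_normal T' // enormN scalerN.
Qed.

Lemma derive_unit_tangent_neq0 s : I s -> derive1 (unit_tangent c) s != 0.
Proof.
move=> Is.
by have [->//|->//] := derive_unit_tangent; rewrite ?oppr_eq0; exact: noncyl.
Qed.

End StrictionLine.

Theorem corollary4p2 (R : realType) (N : ruledSurface R) (k1 k2 : R -> R)
    (Nregular : regular_curve (rs_dom N) (rs_base N))
    (Narclength : unit_speed (rs_dom N) (rs_base N))
    (Nstriction : base_is_striction N)
    (Nnoncyl : noncylindrical N)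
    (Ninvariants : frenet_invariants N k1 k2)
    (k1_neq0 : forall s, rs_dom N s -> k1 s != 0)
    (k2_neq0 : forall s, rs_dom N s -> k2 s != 0)
    (Ndevelopable : developable N) :
  h_slant N <-> slant_helix (rs_dom N) (rs_base N).
Proof.
have T'_neq0 s : rs_dom N s -> derive1 (unit_tangent (rs_base N)) s != 0.
  by move=> Is; exact: derive_unit_tangent_neq0 Ninvariants _ _ _.
(* The sign is the same for all s, so a single axis, u or -u, serves the whole interval. *)
have [nh|nh] := principal_normal_central_normal _ _ _ Narclength Nstriction
  Nnoncyl Ninvariants Ndevelopable.
- split=> [|[_]]; first by split=> //; exact: constant_angle_eq nh _.
  by apply: constant_angle_eq => s Is; rewrite nh.
- split=> [|[_]]; first by split=> //; exact: constant_angleN nh _.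
  by apply: constant_angleN => s Is; rewrite nh // opprK.
Qed.
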